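(* Let $E/K$ be a Galois extension of number fields with Galois group $G(E/K)$, let $A=\mathfrak o_K$, $B=\mathfrak o_E$, let $C(X)\in A[X]$ be monic of degree $d\ge 2$ with simple roots $x_1,\dots,x_d$, such that $E$ is the splitting field of $C$ over $K$, and let $\Delta_C$ be the discriminant of $C$. Then for every $\sigma\in G(E/K)$ there exists a polynomial $\Psi_\sigma(X)$ of degree less than $d$ with coefficients in $\frac{1}{\Delta_C}B$ (i.e. $\Delta_C\Psi_\sigma(X)\in B[X]$) with the following properties: 1. The map $\sigma\mapsto\Psi_\sigma(X)$ from $G(E/K)$ to $\frac{1}{\Delta_C}B[X]$ is injective. 2. If $\sigma$ lies in the center $Z(G(E/K))$, then $\Delta_C\Psi_\sigma(X)\in A[X]$. 3. If $\sigma\in Z(G(E/K))$, then for every sequence $(U_n)$ of class $C$ in $A$ and every $\mathcal P\in\mathbb P(E/K,\sigma)$ one has, in $A$, $$\Delta_C\,U_{N(\mathcal P)}\equiv \Delta_C\,\Psi_\sigma\{U_0\}\pmod{\mathcal P}.$$ 4. For $\sigma=\mathrm{Id}$ one has $\Psi_{\mathrm{Id}}(X)=X$, and for every sequence $(U_n)$ of class $C$ in $A$: $U_{N(\mathcal P)}\equiv U_1 \pmod{\mathcal P}$ for all $\mathcal P\in\mathrm{Split}(E/K)$. 5. For every $\sigma\in G(E/K)$ of order $f\ge 1$, every $\mathcal P\in\mathbb P(E/K,\sigma)$ and every sequence $(U_n)$ of class $C$ in $A$: $U_{N(\mathcal P)^f}\equiv U_1\pmod{\mathcal P}$.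
   Context: $\mathfrak o_K,\mathfrak o_E$ are the rings of integers. For a nonzero prime ideal $\mathcal P$ of $A$, $N(\mathcal P)=|A/\mathcal P|$. For $\sigma\in G(E/K)$, $\mathbb P(E/K,\sigma)$ denotes the set of nonzero prime ideals $\mathcal P$ of $A$ with $\Delta_C\notin\mathcal P$ such that there is a prime ideal $Q$ of $B$ above $\mathcal P$ with Frobenius $\mathrm{Frob}_Q=\sigma$, i.e. $\sigma(x)\equiv x^{N(\mathcal P)}\pmod Q$ for all $x\in B$; $\mathrm{Split}(E/K)=\mathbb P(E/K,\mathrm{Id})$. A sequence $(U_n)_{n\in\mathbb N}$ is of class $C$ in $A$ if every $U_n\in A$ and, writing $C(X)=c_0+c_1X+\dots+c_{d-1}X^{d-1}+X^d$, one has $c_0U_n+c_1U_{n+1}+\dots+c_{d-1}U_{n+d-1}+U_{n+d}=0$ for all $n$. Lucas' symbolic notation: for $F(X)=\sum_k f_kX^k$, $F\{U_0\}:=\sum_k f_kU_k$. *)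

(* Defs.v *)
From HB Require Import structures.
From mathcomp Require Import all_boot all_order all_algebra.
From mathcomp Require Import all_fingroup all_solvable all_field.
From mathcomp Require Import finmap.
From mathcomp Require Import boolp classical_sets cardinality.

Set Implicit Arguments.
Unset Strict Implicit.
Unset Printing Implicit Defensive.

Import GRing.Theory.
Local Open Scope classical_set_scope.
Local Open Scope ring_scope.

(* Number fields are the subfields of a normal number field L (as in galois.v);
   rings of integers, their ideals, and residue classes are subsets of L, so
   that o_K is literally contained in o_E when K is contained in E.           *)
Section NumberFields.

Variable L : splittingFieldType rat.
Implicit Types (K E : {subfield L}) (A P Q : set L) (C F : {poly L}).

Definition int_ring K : set L :=
  [set x | x \in K /\ integralOver (intr : int -> L) x].

Definition poly_in A F : Prop := forall k, A F`_k.

Record is_ideal A P : Prop := IsIdeal {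
  ideal_sub : P `<=` A;
  ideal_zero : P 0;
  ideal_add : forall x y, P x -> P y -> P (x + y);
  ideal_mul : forall a x, A a -> P x -> P (a * x) }.

Record is_prime_ideal A P : Prop := IsPrimeIdeal {
  prime_ideal_ideal : is_ideal A P;
  prime_ideal_proper : ~ P 1;
  prime_ideal_prime : forall x y, A x -> A y -> P (x * y) -> P x \/ P y }.

Definition congr_mod P (x y : L) : Prop := P (x - y).

Definition residue_class A P (a : L) : set L :=
  [set b | A b /\ congr_mod P b a].

(* |A / P|, with junk value 0 if A / P is infinite. *)
Definition ideal_norm A P : nat := #|` fset_set (residue_class A P @` A)|%fset.

(* The discriminant of the monic polynomial with roots x_0, ..., x_(d-1). *)
Definition disc_of_roots d (x : d.-tuple L) : L :=
  \prod_(i < d) \prod_(j < d | (i < j)%N) (tnth x i - tnth x j) ^+ 2.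

(* D stands for the discriminant of the polynomial under consideration. *)
Definition frob_primes K E (D : L) (sigma : gal_of E) : set (set L) :=
  [set P | [/\ is_prime_ideal (int_ring K) P, P <> [set 0], ~ P D &
    exists Q, [/\ is_prime_ideal (int_ring E) Q, Q `&` int_ring K = P &
      forall x, int_ring E x ->
        congr_mod Q (sigma x) (x ^+ ideal_norm (int_ring K) P)]]].

Definition split_primes K E (D : L) : set (set L) :=
  frob_primes K D (1%g : gal_of E).

Definition of_class C A (U : nat -> L) : Prop :=
  (forall n, A (U n)) /\
  (forall n, \sum_(k < size C) C`_k * U (n + k)%N = 0).

(* F{U_0} in Lucas' symbolic notation. *)
Definition lucas F (U : nat -> L) : L := \sum_(k < size F) F`_k * U k.

End NumberFields.

(* Main.v *)
Require Import Defs.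
From HB Require Import structures.
From mathcomp Require Import all_boot all_order all_algebra.
From mathcomp Require Import all_fingroup all_solvable all_field.
From mathcomp Require Import finmap.
From mathcomp Require Import boolp classical_sets cardinality.

Set Implicit Arguments.
Unset Strict Implicit.
Unset Printing Implicit Defensive.

Import GRing.Theory.
Local Open Scope ring_scope.

(** [Psi sigma] is the Lagrange interpolation polynomial taking the value
    [sigma z] at every root [z] of [C]; its denominators divide the
    discriminant, and for central [sigma] it is Galois invariant. Since
    [F |-> F{U_0}] is linear and kills the multiples of [C], Lagrange
    interpolation writes [Delta * F{U_0}] as a [B]-combination of the values of
    [F] at the roots. If these values all lie in [Q], then [F{U_0}] lies in
    [P], because [Delta] does not; the congruences follow by taking [F] to be
    [Delta * (X^N - Psi sigma)], [X^N - X] and [X^(N^f) - X]. *)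

(** * Lagrange interpolation over a field *)

Section Interpolation.

Variable F : fieldType.
Implicit Types (s : seq F) (z y : F) (f : F -> F).

(** For duplicate-free [s] and [z] in [s], this is the derivative of [\prod_(y <- s) ('X - y%:P)] at
    [z]. *)
Definition node_diff s z : F := \prod_(y <- s | y != z) (z - y).

Definition node_poly s z : {poly F} := \prod_(y <- s | y != z) ('X - y%:P).

Definition interpolation s f : {poly F} :=
  \sum_(z <- s) (f z / node_diff s z) *: node_poly s z.

Lemma node_diff_neq0 s z : node_diff s z != 0.
Proof.
by rewrite prodf_seq_neq0; apply/allP=> y _; rewrite subr_eq0 eq_sym; apply/implyP.
Qed.

Lemma horner_node_poly s z y : y \in s ->
  (node_poly s z).[y] = if y == z then node_diff s z else 0.
Proof.
move=> ys; rewrite horner_prod; have [->|nyz] := eqVneq y z.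
  by apply: eq_bigr => a _; rewrite !hornerE.
apply/eqP; rewrite prodf_seq_eq0; apply/hasP; exists y => //.
by rewrite nyz !hornerE subrr eqxx.
Qed.

Lemma horner_interpolation s f y : uniq s -> y \in s ->
  (interpolation s f).[y] = f y.
Proof.
move=> us ys; rewrite horner_sum (bigD1_seq y) //= big1_seq => [|z /andP[nzy zs]].
  by rewrite addr0 hornerZ horner_node_poly // eqxx divfK ?node_diff_neq0.
by rewrite hornerZ horner_node_poly // eq_sym (negPf nzy) mulr0.
Qed.

Lemma size_node_poly s z : uniq s -> z \in s -> size (node_poly s z) = size s.
Proof.
move=> us zs; rewrite /node_poly -big_filter size_prod_XsubC -rem_filter //.
by rewrite size_rem // prednK //; case: s zs {us}.
Qed.

Lemma size_interpolation s f : uniq s -> (size (interpolation s f) <= size s)%N.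
Proof.
move=> us; rewrite /interpolation big_seq.
apply: (big_ind (fun p : {poly F} => size p <= size s)%N); first by rewrite size_poly0.
  by move=> p q sp sq; rewrite (leq_trans (size_polyD _ _)) // geq_max sp.
by move=> z zs; rewrite (leq_trans (size_scale_leq _ _)) // size_node_poly.
Qed.

Lemma eq_poly_on_nodes s (p q : {poly F}) : uniq s ->
  (size p <= size s)%N -> (size q <= size s)%N ->
  {in s, forall z, p.[z] = q.[z]} -> p = q.
Proof.
move=> us sp sq epq; apply/eqP; rewrite -subr_eq0; apply/eqP.
apply: (roots_geq_poly_eq0 _ us).
  by apply/allP=> z zs; rewrite rootE !hornerE epq // subrr.
by rewrite (leq_trans (size_polyD _ _)) // size_polyN geq_max sp.
Qed.

(** The modulus vanishes at the nodes, so the remainder keeps the values of [p] there, and its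
    degree is small enough for these values to determine it. *)
Lemma modp_prod_XsubC s (p : {poly F}) : uniq s ->
  p %% \prod_(z <- s) ('X - z%:P) = interpolation s (horner p).
Proof.
move=> us; apply: (eq_poly_on_nodes us); rewrite ?size_interpolation //.
  rewrite -ltnS -(size_prod_XsubC s id) ltn_modp -size_poly_eq0.
  by rewrite size_prod_XsubC.
move=> z zs; rewrite horner_interpolation //.
set C := \prod_(z <- s) _; have /rootP Cz: root C z by rewrite root_prod_XsubC.
by rewrite [in RHS](divp_eq p C) !hornerE Cz mulr0 add0r.
Qed.

Lemma map_node_diff (g : {rmorphism F -> F}) s z : perm_eq (map g s) s ->
  node_diff s (g z) = g (node_diff s z).
Proof.
move=> gs; rewrite /node_diff -(perm_big _ gs) big_map rmorph_prod.
by apply: eq_big => [y|y _]; rewrite ?rmorphB // (inj_eq (fmorph_inj g)).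
Qed.

Lemma map_node_poly (g : {rmorphism F -> F}) s z : perm_eq (map g s) s ->
  node_poly s (g z) = map_poly g (node_poly s z).
Proof.
move=> gs; rewrite /node_poly -(perm_big _ gs) big_map map_prod_XsubC.
by apply: eq_bigl => y; rewrite (inj_eq (fmorph_inj g)).
Qed.

(** As [g] permutes the nodes, reindexing the sum along [g] turns the term at [z] into its image
    under [g]. *)
Lemma map_interpolation (g : {rmorphism F -> F}) s f : perm_eq (map g s) s ->
  {in s, forall z, g (f z) = f (g z)} ->
  map_poly g (interpolation s f) = interpolation s f.
Proof.
move=> gs gf; rewrite [in RHS]/interpolation -(perm_big _ gs) big_map rmorph_sum.
rewrite !big_seq; apply: eq_bigr => z zs.
by rewrite /= map_polyZ fmorph_div gf // map_node_poly // map_node_diff.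
Qed.

End Interpolation.

(** * Lucas' symbolic evaluation on recurrent sequences *)

Section Lucas.

Variable L : splittingFieldType rat.
Implicit Types (F G C : {poly L}) (U : nat -> L).

Lemma lucas_widen F U n : (size F <= n)%N -> lucas F U = \sum_(k < n) F`_k * U k.
Proof.
move=> le_n; rewrite /lucas (big_ord_widen n (fun k => F`_k * U k)) // big_mkcond /=.
by apply: eq_bigr => k _; case: ltnP => // ?; rewrite nth_default ?mul0r.
Qed.

Lemma lucasD F G U : lucas (F + G) U = lucas F U + lucas G U.
Proof.
rewrite (lucas_widen U (size_polyD F G)) (lucas_widen U (leq_maxl _ (size G))).
rewrite (lucas_widen U (leq_maxr (size F) _)) -big_split.
by apply: eq_bigr => k _; rewrite coefD mulrDl.
Qed.

Lemma lucasZ a F U : lucas (a *: F) U = a * lucas F U.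
Proof.
rewrite (lucas_widen U (size_scale_leq a F)) mulr_sumr.
by apply: eq_bigr => k _; rewrite coefZ mulrA.
Qed.

Lemma lucas0 U : lucas 0 U = 0.
Proof. by rewrite /lucas size_poly0 big_ord0. Qed.

Lemma lucasB F G U : lucas (F - G) U = lucas F U - lucas G U.
Proof. by rewrite lucasD -scaleN1r lucasZ mulN1r. Qed.

Lemma lucas_sum (I : Type) (r : seq I) (F : I -> {poly L}) U :
  lucas (\sum_(i <- r) F i) U = \sum_(i <- r) lucas (F i) U.
Proof. by apply: (big_morph (fun G => lucas G U) (fun G1 G2 => lucasD G1 G2 U) (lucas0 U)). Qed.

Lemma lucasXn n U : lucas 'X^n U = U n.
Proof.
rewrite /lucas size_polyXn big_ord_recr /= coefXn eqxx mul1r big1 ?add0r // => k _.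
by rewrite coefXn ltn_eqF ?mul0r.
Qed.

Lemma lucasMX F U : lucas (F * 'X) U = lucas F (U \o S).
Proof.
rewrite (@lucas_widen _ U (size F).+1) //.
  rewrite big_ord_recl coefMX mul0r add0r.
  by apply: eq_bigr => k _; rewrite coefMX.
by rewrite (leq_trans (size_polyMleq _ _)) // size_polyX addnC.
Qed.

(** Induction on [F], for all [U] at once. In [F * 'X + c], the constant contributes [c] times the
    recurrence at index 0, and [F * 'X] becomes [F] on the shifted sequence, which is again of class
    [C]. *)
Lemma lucas_mull_class C A F U : of_class C A U -> lucas (F * C) U = 0.
Proof.
elim/poly_ind: F U => [|F c IHF] U clU; first by rewrite mul0r lucas0.
rewrite mulrDl mulrAC lucasD lucasMX mul_polyC lucasZ IHF.
  by have := clU.2 0%N; rewrite /lucas add0r => ->; rewrite mulr0.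
split=> n; first exact: clU.1.
by rewrite -[RHS](clU.2 n.+1); apply: eq_bigr => k _; rewrite addSn.
Qed.

Lemma lucas_interpolation C A F U (s : seq L) : of_class C A U -> uniq s ->
  C = \prod_(z <- s) ('X - z%:P) ->
  lucas F U = \sum_(z <- s) F.[z] * lucas ((node_diff s z)^-1 *: node_poly s z) U.
Proof.
move=> clU us Cs; rewrite [in LHS](divp_eq F C) lucasD (lucas_mull_class _ clU).
rewrite add0r Cs modp_prod_XsubC // lucas_sum.
by apply: eq_bigr => z _; rewrite -scalerA lucasZ.
Qed.

End Lucas.

(** * Closure properties of the rings of integers *)

Section IntegerRing.

Variable L : splittingFieldType rat.
Implicit Types (K E : {subfield L}) (P Q : set L) (C F : {poly L}).

(** A boolean predicate, so that it can carry a subring structure and the [rpred] lemmas apply. *)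
Definition int_mem K : {pred L} := fun x => `[< int_ring K x >].

Lemma int_memP K x : reflect (int_ring K x) (x \in int_mem K).
Proof. exact: asboolP. Qed.

Fact int_mem_subring K : subring_closed (int_mem K).
Proof.
split=> [|a b /int_memP[Ka ia] /int_memP[Kb ib]|a b /int_memP[Ka ia] /int_memP[Kb ib]].
- by apply/int_memP; split; [apply: mem1v | apply: integral1].
- by apply/int_memP; split; [apply: rpredB | apply: integral_sub].
- by apply/int_memP; split; [apply: rpredM | apply: integral_mul].
Qed.
HB.instance Definition _ K :=
  GRing.isSubringClosed.Build L (int_mem K) (int_mem_subring K).

Lemma poly_inP K F : reflect (poly_in (int_ring K) F) (F \is a polyOver (int_mem K)).
Proof.
by apply: (iffP polyOverP) => FK k; [apply/int_memP/FK | apply/int_memP/FK].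
Qed.

(** A monic integer polynomial killing [z] also kills [sigma z], since [sigma] fixes its
    coefficients. *)
Lemma int_mem_gal E (sigma : gal_of E) z : z \in int_mem E -> sigma z \in int_mem E.
Proof.
case/int_memP=> Ez [p mp pz]; apply/int_memP; split; first exact: memv_gal.
exists p => //; have := rmorph_root sigma pz; rewrite -map_poly_comp.
by congr root; apply: eq_map_poly => n /=; rewrite rmorph_int.
Qed.

Lemma int_mem_root K E C z : poly_in (int_ring K) C -> C \is monic ->
  root C z -> z \in E -> z \in int_mem E.
Proof.
move=> CK mC Cz Ez; apply/int_memP; split=> //.
by apply: (integral_root_monic mC Cz); apply/integral_poly => i; case: (CK i).
Qed.

Lemma ideal_sum (I : eqType) (r : seq I) A Q (f : I -> L) : is_ideal A Q ->
  (forall i, i \in r -> Q (f i)) -> Q (\sum_(i <- r) f i).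
Proof.
move=> [_ Q0 QD _] Qf; rewrite big_seq; exact: (big_ind Q).
Qed.

Lemma int_mem_lucas E F U : F \is a polyOver (int_mem E) ->
  (forall n, U n \in int_mem E) -> lucas F U \in int_mem E.
Proof.
move=> /polyOverP EF EU; rewrite /lucas rpred_sum // => k _.
by apply: rpredM; [apply: EF | apply: EU].
Qed.

Lemma int_memS K E : (K <= E)%VS -> {subset int_mem K <= int_mem E}.
Proof. by move=> /subvP sKE z /int_memP[Kz iz]; apply/int_memP; split; first exact: sKE. Qed.

End IntegerRing.

(** * The discriminant as a common denominator *)

Section Discriminant.

Variables (L : splittingFieldType rat) (d : nat) (x : d.-tuple L).
Hypothesis ux : uniq x.

(** Each square is [(x_i - x_j) ^+ 2 = - (x_i - x_j) * (x_j - x_i)]. In this form every [node_diff]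
    at a root is visibly a factor of the discriminant. *)
Lemma disc_of_rootsE :
  exists b : bool,
    disc_of_roots x = (-1) ^+ b * \prod_(z <- x) node_diff x z.
Proof.
have teq i j : (tnth x i == tnth x j) = (i == j) by rewrite (inj_eq (tuple_uniqP _ ux)).
(* One sign per unordered pair, charged to the ordered pair with [j < i]. *)
pose s (i j : 'I_d) : L := (-1) ^+ (j < i)%N.
suff ->: disc_of_roots x =
    (\prod_(i < d) \prod_(j < d | j != i) s i j) * \prod_(z <- x) node_diff x z.
  exists (odd (\sum_(i < d) \sum_(j < d | j != i) (j < i)%N)); congr (_ * _).
  rewrite signr_odd expr_sum.
  by apply: eq_bigr => i _; rewrite expr_sum.
have -> : \prod_(z <- x) node_diff x z =
    \prod_(i < d) \prod_(j < d | j != i) (tnth x i - tnth x j).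
  rewrite big_tuple; apply: eq_bigr => i _; rewrite /node_diff big_tuple.
  by apply: eq_bigl => j; rewrite teq.
rewrite -big_split /=.
(* Separate the pairs with [i < j] from those with [j < i], then exchange the indices in the latter
   so that both products run over [i < j]. *)
under [RHS]eq_bigr => i _.
  rewrite -big_split (bigID (fun j : 'I_d => (i < j)%N)) /=; over.
rewrite big_split /= [X in _ * X](exchange_big_dep predT) //= -big_split /=.
apply: eq_bigr => i _; rewrite (eq_bigl (fun j : 'I_d => (i < j)%N)); last first.
  by move=> j; rewrite -(inj_eq val_inj) /=; case: ltngtP.
rewrite [X in _ * X](eq_bigl (fun j : 'I_d => (i < j)%N)); last first.
  by move=> j; rewrite -leqNgt -(inj_eq val_inj) /=; case: ltngtP.
rewrite -big_split /=; apply: eq_bigr => j ij.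
by rewrite /s ij ltnNge (ltnW ij) mul1r mulN1r opprB expr2.
Qed.

Lemma disc_div_node_diff (E : {subfield L}) z : {subset x <= int_mem E} ->
  z \in x -> disc_of_roots x / node_diff x z \in int_mem E.
Proof.
move=> xE zx; have [b ->] := disc_of_rootsE.
rewrite (bigD1_seq z) //= mulrCA mulrAC mulfV ?node_diff_neq0 // mul1r.
rewrite rpredM ?rpred_sign // big_seq_cond rpred_prod // => y /andP[yx _].
rewrite /node_diff big_seq_cond rpred_prod // => t /andP[tx _].
by rewrite rpredB ?xE.
Qed.

Lemma rmorph_disc (g : {rmorphism L -> L}) : perm_eq (map g x) x ->
  g (disc_of_roots x) = disc_of_roots x.
Proof.
move=> gx; have [b ->] := disc_of_rootsE.
rewrite rmorphM rmorph_sign rmorph_prod -[in RHS](perm_big _ gx) big_map.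
by congr (_ * _); apply: eq_bigr => z _; rewrite map_node_diff.
Qed.

Lemma disc_int_mem (E : {subfield L}) : {subset x <= int_mem E} ->
  disc_of_roots x \in int_mem E.
Proof.
by move=> xE; do 2!rewrite rpred_prod // => ? _; rewrite rpredX ?rpredB ?xE ?mem_tnth.
Qed.

Lemma disc_node_poly (E : {subfield L}) z : {subset x <= int_mem E} ->
  z \in x -> (disc_of_roots x / node_diff x z) *: node_poly x z
    \is a polyOver (int_mem E).
Proof.
move=> xE zx; rewrite polyOverZ ?disc_div_node_diff //.
by rewrite /node_poly big_seq_cond rpred_prod // => y /andP[yx _]; rewrite polyOverXsubC xE.
Qed.

Lemma disc_interpolation (E : {subfield L}) (f : L -> L) : {subset x <= int_mem E} ->
  {in x, forall z, f z \in int_mem E} ->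
  disc_of_roots x *: interpolation x f \is a polyOver (int_mem E).
Proof.
move=> xE fE; rewrite scaler_sumr big_seq rpred_sum // => z zx.
by rewrite scalerA mulrCA -scalerA polyOverZ ?fE ?disc_node_poly.
Qed.

(** The discriminant clears the denominators of the interpolation weights, so its product with
    [lucas F U] lies in [Q], hence in [P]; primality of [P] then removes it. *)
Lemma lucas_in_prime (K E : {subfield L}) (C F : {poly L}) (U : nat -> L)
    (P Q : set L) :
    (K <= E)%VS -> {subset x <= int_mem E} ->
    C = \prod_(z <- x) ('X - z%:P) -> of_class C (int_ring K) U ->
    is_prime_ideal (int_ring K) P -> is_prime_ideal (int_ring E) Q ->
    (Q `&` int_ring K)%classic = P -> ~ P (disc_of_roots x) ->
    int_ring K (disc_of_roots x) ->
    int_ring K (lucas F U) -> {in x, forall z, Q F.[z]} ->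
  P (lucas F U).
Proof.
move=> sKE xE Cx clU primeP primeQ QK PD KD KF QF.
suff PDF : P (disc_of_roots x * lucas F U).
  by case: (prime_ideal_prime primeP KD KF PDF).
rewrite -QK; split; last by apply/int_memP; rewrite rpredM //; apply/int_memP.
rewrite (lucas_interpolation _ clU ux Cx) mulr_sumr.
apply: (ideal_sum (prime_ideal_ideal primeQ)) => z zx.
rewrite mulrCA -lucasZ scalerA mulrC.
apply: (ideal_mul (prime_ideal_ideal primeQ)); last exact: QF.
apply/int_memP; rewrite int_mem_lucas ?disc_node_poly // => n.
by apply: (int_memS sKE); apply/int_memP/clU.1.
Qed.

End Discriminant.

(** * Galois action on the roots and Frobenius congruences *)

Section Galois.

Variable L : splittingFieldType rat.
Implicit Types (K E : {subfield L}) (s : seq L).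

Lemma splitting_roots K E C s : C = \prod_(z <- s) ('X - z%:P) ->
  splittingFieldFor K C E -> <<K & s>>%VS = E.
Proof.
move=> -> [rs]; rewrite eqp_monic ?monic_prod_XsubC // => /eqP e <-.
by rewrite (eq_span (_ : s =i rs)) // => z; rewrite -!root_prod_XsubC e.
Qed.

Lemma perm_gal_roots K E (sigma : gal_of E) C s : (K <= E)%VS ->
  sigma \in 'Gal(E / K)%g -> C \is a polyOver K ->
  C = \prod_(z <- s) ('X - z%:P) -> perm_eq (map sigma s) s.
Proof.
move=> sKE sG KC Cs; apply: prod_XsubC_eq.
by rewrite big_map -map_prod_XsubC -Cs (fixedPoly_gal sKE).
Qed.

(** The fixed field of [sigma * tau^-1] contains [K] and [s], hence all of [E]. *)
Lemma gal_eq_on_generators K E (sigma tau : gal_of E) s : (K <= E)%VS ->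
  <<K & s>>%VS = E -> sigma \in 'Gal(E / K)%g -> tau \in 'Gal(E / K)%g ->
  {in s, sigma =1 tau} -> sigma = tau.
Proof.
move=> sKE genE sG tG est.
have sE z : z \in s -> z \in E by move=> zs; rewrite -genE seqv_sub_adjoin.
have sEF : (E <= fixedField [set (sigma * tau^-1)%g])%VS.
  rewrite -{1}genE; apply/Fadjoin_seqP; split.
    by rewrite -galois_connection // finset.sub1set groupM ?groupV //.
  move=> z zs; apply/fixedFieldP; rewrite ?sE // => _ /set1P ->.
  by rewrite galM ?sE // est // -galM ?sE // mulgV gal_id.
apply/eqP; rewrite eq_mulgV1; apply/gal_eqP => z /(subvP sEF).
by case/mem_fixedFieldP=> _ fix_z; rewrite fix_z ?set11 // gal_id.
Qed.

Lemma frob_iter E (sigma : gal_of E) (Q : set L) N z n :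
    is_ideal (int_ring E) Q ->
    (forall z, int_ring E z -> congr_mod Q (sigma z) (z ^+ N)) ->
  int_ring E z -> congr_mod Q ((sigma ^+ n)%g z) (z ^+ (N ^ n)).
Proof.
move=> idQ frob Ez; elim: n => [|n IHn].
  by rewrite expg0 gal_id expn0 expr1 /congr_mod subrr; case: idQ.
have Esz : (sigma ^+ n)%g z \in int_mem E by apply/int_mem_gal/int_memP.
rewrite expgSr galM ?(proj1 Ez) // expnSr exprM /congr_mod.
set y := (sigma ^+ n)%g z in IHn Esz *.
(* Pass through [y ^+ N]: Frobenius at [y] handles the first difference, and [a - b] divides
   [a ^+ N - b ^+ N] for the second. *)
rewrite -[_ - _](subrKA (y ^+ N)); apply: (ideal_add idQ); first exact/frob/int_memP.
rewrite subrXX mulrC; apply: (ideal_mul idQ) IHn; apply/int_memP.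
by rewrite rpred_sum // => i _; rewrite rpredM ?rpredX //; apply/int_memP.
Qed.

End Galois.

Theorem theorem4 (L : splittingFieldType rat) (K E : {subfield L})
    (galKE : galois K E)
    (d : nat) (d_ge2 : (2 <= d)%N)
    (C : {poly L}) (C_int : poly_in (int_ring K) C)
    (C_monic : C \is monic) (C_deg : size C = d.+1)
    (x : d.-tuple L) (x_roots : C = \prod_(z <- x) ('X - z%:P))
    (x_simple : uniq x)
    (splitC : splittingFieldFor K C E) :
  let A := int_ring K in
  let B := int_ring E in
  let G := ('Gal(E / K))%g in
  let Delta := disc_of_roots x in
  exists Psi : gal_of E -> {poly L},
    (forall sigma, sigma \in G ->
       (size (Psi sigma) <= d)%N /\ poly_in B (Delta *: Psi sigma)) /\
    [/\ {in G &, injective Psi},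
        forall sigma, sigma \in ('Z(G))%g -> poly_in A (Delta *: Psi sigma),
        forall sigma, sigma \in ('Z(G))%g ->
          forall U, of_class C A U ->
          forall P, frob_primes K Delta sigma P ->
            congr_mod P (Delta * U (ideal_norm A P))
                        (Delta * lucas (Psi sigma) U),
        Psi 1%g = 'X /\
          (forall U, of_class C A U ->
           forall P, split_primes K E Delta P ->
             congr_mod P (U (ideal_norm A P)) (U 1%N)) &
        forall sigma, sigma \in G ->
          forall P, frob_primes K Delta sigma P ->
          forall U, of_class C A U ->
            congr_mod P (U (ideal_norm A P ^ #[sigma]%g)%N) (U 1%N)].
Proof.
move=> A B G Delta; have sKE : (K <= E)%VS by case/and3P: galKE.
have genE := splitting_roots x_roots splitC.
have Cx z : z \in x -> root C z by rewrite x_roots root_prod_XsubC.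
have xB : {subset x <= int_mem E}.
  move=> z zx; apply: (int_mem_root C_int C_monic (Cx z zx)).
  by rewrite -genE seqv_sub_adjoin.
have xE z : z \in x -> z \in E by move/xB/int_memP=> [].
have KC : C \is a polyOver K by apply/polyOverP => k; case: (C_int k).
have permG tau : tau \in G -> perm_eq (map tau x) x.
  by move=> tG; apply: (perm_gal_roots sKE tG KC x_roots).
have fixK a : a \in int_mem E -> (forall tau, tau \in G -> tau a = a) ->
    a \in int_mem K.
  case/int_memP=> Ea ia fix_a; apply/int_memP; split=> //.
  by rewrite -(galois_fixedField galKE); apply/fixedFieldP.
have AD : int_ring K Delta.
  apply/int_memP/fixK => [|tau tG]; first exact: disc_int_mem.
  exact/(rmorph_disc x_simple)/permG.
pose Psi (sigma : gal_of E) := interpolation x sigma.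
have PsiB sigma : Delta *: Psi sigma \is a polyOver (int_mem E).
  by apply: disc_interpolation => // z zx; apply/int_mem_gal/xB.
(* Centrality gives [tau (sigma z) = sigma (tau z)] at the roots, so every [tau] in [G] fixes the
   coefficients. *)
have PsiA sigma : sigma \in 'Z(G)%g -> Delta *: Psi sigma \is a polyOver (int_mem K).
  case/setIP=> sG /centP cGs; apply/polyOverP=> k.
  apply: fixK => [|tau tG]; first exact/polyOverP/PsiB.
  rewrite -coef_map map_polyZ (rmorph_disc x_simple (permG _ tG)) map_interpolation //.
    exact: permG.
  by move=> z zx /=; rewrite -!galM ?xE // cGs.
(* Here [2 <= d] matters: it makes ['X] small enough to be determined by its values at the [d]
   roots. *)
have Psi1 : Psi 1%g = 'X.
  apply: (eq_poly_on_nodes x_simple); rewrite ?size_interpolation //.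
    by rewrite size_polyX size_tuple.
  by move=> z zx; rewrite horner_interpolation // hornerX gal_id.
(* Serves the last two claims, with [n = 1] and with [n] the order of [sigma]. At a root [z], the
   value of ['X^(N ^ n) - 'X] is in [Q] because [z] equals [(sigma ^+ n) z]. *)
have pow U n P (sigma : gal_of E) : of_class C A U -> frob_primes K Delta sigma P ->
    (sigma ^+ n = 1)%g -> congr_mod P (U (ideal_norm A P ^ n)%N) (U 1%N).
  move=> clU [primeP _ PD [Q [primeQ QP frob]]] sn1.
  rewrite /congr_mod -(lucasXn _ U) -(lucasXn 1 U) -lucasB.
  apply: (lucas_in_prime x_simple sKE xB x_roots clU primeP primeQ QP PD AD).
    rewrite lucasB !lucasXn; apply/int_memP.
    by rewrite rpredB //; apply/int_memP/clU.1.
  move=> z /xB/int_memP Bz; have idQ := prime_ideal_ideal primeQ.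
  have := frob_iter n idQ frob Bz; rewrite sn1 gal_id /congr_mod => Qz.
  rewrite !hornerE -opprB -mulN1r; apply: (ideal_mul idQ) => //.
  by apply/int_memP; rewrite rpredN rpred1.
exists Psi; split=> [sigma _|].
  split; last exact/poly_inP/PsiB.
  by rewrite -[X in (_ <= X)%N](size_tuple x) size_interpolation.
split.
(* The value of [Psi sigma] at a root is its image under [sigma], and the roots generate [E] over
   [K]. *)
- move=> sigma tau sG tG eqPsi.
  apply: (gal_eq_on_generators sKE genE sG tG) => z zx.
  rewrite -(horner_interpolation sigma x_simple zx).
  by rewrite -[interpolation _ _]/(Psi sigma) eqPsi horner_interpolation.
- by move=> sigma /PsiA/poly_inP.
- move=> sigma sZ U clU P [primeP _ PD [Q [primeQ QP frob]]].
  (* [Delta] is kept inside the polynomial so that its coefficients, and hence its symbolic value,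
     are integral in [K]. *)
  rewrite /congr_mod -(lucasXn _ U) -mulrBr -lucasB -lucasZ.
  apply: (lucas_in_prime x_simple sKE xB x_roots clU primeP primeQ QP PD AD).
    apply/int_memP/int_mem_lucas => [|n]; last exact/int_memP/clU.1.
    rewrite scalerBr rpredB ?PsiA // polyOverZ ?rpredX ?polyOverX //.
    exact/int_memP.
  move=> z zx; have idQ := prime_ideal_ideal primeQ.
  rewrite !hornerE horner_interpolation // -opprB mulrN -mulNr.
  apply: (ideal_mul idQ); last exact/frob/int_memP/xB.
  by apply/int_memP; rewrite rpredN disc_int_mem.
- by split=> // U clU P splP; apply: (pow U 1%N P 1%g clU splP); rewrite expg1.
- by move=> sigma _ P frobP U clU; apply: pow clU frobP (expg_order sigma).
Qed.
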